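(* For every constant $c>0$ there are constants $A_c>0$ and $0<\beta_c<1$, depending only on $c$, such that the following holds. For every maximal planar graph $G$ with $n$ vertices, every planar straight-line drawing of $G$ in the hyperbolic plane with vertex-vertex resolution at least $c$ has angular resolution at most $A_c\,\beta_c^{\,n}$.
   Context: The hyperbolic plane is the complete simply connected Riemannian surface of constant curvature $-1$. A planar straight-line hyperbolic drawing of a graph places the vertices at distinct points of the hyperbolic plane and draws each edge as the hyperbolic geodesic segment between its endpoints, so that no two edges intersect except at a common endpoint and no edge passes through a vertex other than its endpoints. The vertex-vertex resolution of a drawing is the minimum hyperbolic distance between two distinct vertices. The angular resolution of a drawing is the minimum angle formed at a vertex between two edges incident to that vertex. A maximal planar graph is a planar graph to which no edge can be added while preserving planarity. *)

(* Defs.v *)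
From Stdlib Require Import Reals Lra.
Open Scope R_scope.

Definition simple_graph (n : nat) (E : nat -> nat -> Prop) : Prop :=
  (forall u v, E u v -> (u < n)%nat /\ (v < n)%nat) /\
  (forall u v, E u v -> E v u) /\
  (forall u, ~ E u u).

Definition add_edge (E : nat -> nat -> Prop) (u v : nat) : nat -> nat -> Prop :=
  fun a b => E a b \/ (a = u /\ b = v) \/ (a = v /\ b = u).

Definition pt2 := (R * R)%type.

Definition cont01 (g : R -> pt2) : Prop :=
  forall s, 0 <= s <= 1 -> forall eps, 0 < eps -> exists delta, 0 < delta /\
    forall t, 0 <= t <= 1 -> Rabs (t - s) < delta ->
      Rabs (fst (g t) - fst (g s)) < eps /\ Rabs (snd (g t) - snd (g s)) < eps.

Definition inj01 (g : R -> pt2) : Prop :=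
  forall s t, 0 <= s <= 1 -> 0 <= t <= 1 -> g s = g t -> s = t.

Definition same_edge (a b c d : nat) : Prop :=
  (a = c /\ b = d) \/ (a = d /\ b = c).

Definition planar (n : nat) (E : nat -> nat -> Prop) : Prop :=
  exists (p : nat -> pt2) (g : nat -> nat -> R -> pt2),
    (forall u v, (u < n)%nat -> (v < n)%nat -> p u = p v -> u = v) /\
    (forall a b, E a b ->
       cont01 (g a b) /\ inj01 (g a b) /\ g a b 0 = p a /\ g a b 1 = p b) /\
    (forall a b w s, E a b -> (w < n)%nat -> 0 <= s <= 1 ->
       g a b s = p w -> w = a \/ w = b) /\
    (forall a b c d s t, E a b -> E c d -> ~ same_edge a b c d ->
       0 <= s <= 1 -> 0 <= t <= 1 -> g a b s = g c d t ->
       exists z, (z = a \/ z = b) /\ (z = c \/ z = d) /\ g a b s = p z).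

Definition maximal_planar (n : nat) (E : nat -> nat -> Prop) : Prop :=
  simple_graph n E /\ planar n E /\
  forall u v, (u < n)%nat -> (v < n)%nat -> u <> v -> ~ E u v ->
    ~ planar n (add_edge E u v).

(* ---------- The hyperbolic plane: hyperboloid model ---------- *)
Definition pt3 := (R * R * R)%type.

Definition mink (x y : pt3) : R :=
  match x, y with (x0, x1, x2), (y0, y1, y2) => - x0 * y0 + x1 * y1 + x2 * y2 end.

Definition on_H2 (x : pt3) : Prop :=
  mink x x = -1 /\ 0 < fst (fst x).

Definition add3 (x y : pt3) : pt3 :=
  match x, y with (x0, x1, x2), (y0, y1, y2) => (x0 + y0, x1 + y1, x2 + y2) end.
Definition scal3 (a : R) (x : pt3) : pt3 :=
  match x with (x0, x1, x2) => (a * x0, a * x1, a * x2) end.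

Definition arcosh (x : R) : R := ln (x + sqrt (x * x - 1)).

Definition hdist (x y : pt3) : R := arcosh (- mink x y).

(* the hyperbolic geodesic segment [p,q]: points of H^2 on the rays through the
   Euclidean segment [p,q] (intersection of H^2 with the plane through 0,p,q,
   between p and q) *)
Definition hseg (p q x : pt3) : Prop :=
  on_H2 x /\ exists t s, 0 <= t <= 1 /\ 0 < s /\
    x = scal3 s (add3 (scal3 (1 - t) p) (scal3 t q)).

(* initial tangent vector at p of the geodesic from p to q (projection of q onto
   the tangent plane T_p H^2 = p^perp) *)
Definition tangent (p q : pt3) : pt3 := add3 q (scal3 (mink p q) p).

Definition hangle (p q r : pt3) : R :=
  let u := tangent p q in let v := tangent p r in
  acos (mink u v / sqrt (mink u u * mink v v)).

Definition hyp_drawing (n : nat) (E : nat -> nat -> Prop) (pos : nat -> pt3) : Prop :=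
  (forall v, (v < n)%nat -> on_H2 (pos v)) /\
  (forall u v, (u < n)%nat -> (v < n)%nat -> pos u = pos v -> u = v) /\
  (forall a b w, E a b -> (w < n)%nat -> hseg (pos a) (pos b) (pos w) ->
     w = a \/ w = b) /\
  (forall a b c d x, E a b -> E c d -> ~ same_edge a b c d ->
     hseg (pos a) (pos b) x -> hseg (pos c) (pos d) x ->
     exists z, (z = a \/ z = b) /\ (z = c \/ z = d) /\ x = pos z).

Definition vv_resolution_ge (n : nat) (pos : nat -> pt3) (c : R) : Prop :=
  forall u v, (u < n)%nat -> (v < n)%nat -> u <> v -> c <= hdist (pos u) (pos v).

(* angular resolution (minimum over the finitely many angles between two edges
   at a common vertex) is <= x *)
Definition angular_resolution_le (n : nat) (E : nat -> nat -> Prop)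
  (pos : nat -> pt3) (x : R) : Prop :=
  exists v u w, (v < n)%nat /\ E v u /\ E v w /\ u <> w /\
    hangle (pos v) (pos u) (pos w) <= x.

(* Main.v *)
(* The Klein model turns the hyperbolic drawing into a straight-line drawing in the plane.
   Two vertices on the boundary of the convex hull can be joined by a path outside the
   hull, so by maximality they are adjacent; since the diagonals of a convex quadrilateral
   cross, all vertices lie in a triangle of three pairwise adjacent vertices.  A hyperbolic
   triangle is thin: each of its points is within bounded distance of one of two fixed
   sides, so c-separation bounds n by a linear function of the longest side length.
   Finally, at one end of the longest side the angle is exponentially small in its length,
   because 1 - cos of the angle opposite to the shortest side is at most 1 / sinh of an
   adjacent side. *)
Require Import Defs.
From Stdlib Require Import Reals ZArith Lra Lia Psatz Classical List.
Open Scope R_scope.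

(** * Edges drawn outside the convex hull *)

(** The obstacle is uniformity: the enclosing triangle is arbitrary and its sides have no common
    upper bound, while every constant may depend on [c] only. It enters through [k = cosh c] and
    [k^2 / (k^2 - 1)], which bounds coth^2 of every distance between vertices. Working with the cosh
    of distances turns the metric claims into inequalities between Minkowski products. The convex
    hull is never constructed: a vertex of maximal norm and the two extreme directions seen from it
    give the triangle, and maximality excludes vertices beyond it. If X is the cosh of the longest
    side, packing gives [n <= K1 + K2 * ln X], and the angle is at most a constant times [X^(-1/2)],
    the square root coming from [1 - cos] being quadratic; hence [beta = exp (- 1 / (2 * K2))]. *)

Definition seg2 (a b : pt2) (t : R) : pt2 :=
  ((1 - t) * fst a + t * fst b, (1 - t) * snd a + t * snd b).

Definition aff (l m k : R) (q : pt2) : R := l * fst q + m * snd q + k.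

Definition orient (a b c : pt2) : R :=
  (fst b - fst a) * (snd c - snd a) - (snd b - snd a) * (fst c - fst a).

Definition straight_drawing (n : nat) (E : nat -> nat -> Prop) (p : nat -> pt2) : Prop :=
  (forall u v, (u < n)%nat -> (v < n)%nat -> p u = p v -> u = v) /\
  (forall a b w s, E a b -> (w < n)%nat -> 0 <= s <= 1 ->
     seg2 (p a) (p b) s = p w -> w = a \/ w = b) /\
  (forall a b c d s t, E a b -> E c d -> ~ same_edge a b c d ->
     0 <= s <= 1 -> 0 <= t <= 1 -> seg2 (p a) (p b) s = seg2 (p c) (p d) t ->
     exists z, (z = a \/ z = b) /\ (z = c \/ z = d) /\ seg2 (p a) (p b) s = p z).

(* Traverses [a, z] for [t <= 1/2] and [z, b] for [t >= 1/2]. *)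
Definition bent (a z b : pt2) (t : R) : pt2 :=
  let y := 1 - 2 * t in
  ((y + Rabs y) / 2 * fst a + (Rabs y - y) / 2 * fst b + (1 - Rabs y) * fst z,
   (y + Rabs y) / 2 * snd a + (Rabs y - y) / 2 * snd b + (1 - Rabs y) * snd z).

Lemma bent_first_half (a z b : pt2) (t : R) : t <= 1 / 2 ->
  bent a z b t = seg2 a z (2 * t).
Proof.
  intros H; unfold bent, seg2; rewrite Rabs_right by lra; f_equal; field.
Qed.

Lemma bent_second_half (a z b : pt2) (t : R) : 1 / 2 <= t ->
  bent a z b t = seg2 z b (2 * t - 1).
Proof.
  intros H; unfold bent, seg2; rewrite Rabs_left1 by lra; f_equal; field.
Qed.

Lemma aff_seg2 (l m k : R) (a b : pt2) (t : R) :
  aff l m k (seg2 a b t) = (1 - t) * aff l m k a + t * aff l m k b.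
Proof. unfold aff, seg2; simpl; ring. Qed.

Lemma pt2_ext (a b : pt2) : fst a = fst b -> snd a = snd b -> a = b.
Proof. destruct a, b; simpl; intros; subst; reflexivity. Qed.

Lemma lipschitz_cont01 (g : R -> pt2) (L : R) :
  (forall s t, Rabs (fst (g t) - fst (g s)) <= L * Rabs (t - s) /\
               Rabs (snd (g t) - snd (g s)) <= L * Rabs (t - s)) ->
  cont01 g.
Proof.
  intros H s _ eps Heps.
  assert (HL : 0 < Rabs L + 1) by (pose proof (Rabs_pos L); lra).
  exists (eps / (Rabs L + 1)); split; [apply Rdiv_lt_0_compat; lra|].
  intros t _ Ht.
  assert (Hlt : L * Rabs (t - s) < eps).
  { apply (Rmult_lt_compat_r _ _ _ HL) in Ht.
    replace (eps / (Rabs L + 1) * (Rabs L + 1)) with eps in Ht by (field; lra).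
    pose proof (Rle_abs L); pose proof (Rabs_pos (t - s)); nra. }
  destruct (H s t); lra.
Qed.

Lemma seg2_cont01 (a b : pt2) : cont01 (seg2 a b).
Proof.
  apply (lipschitz_cont01 _ (Rabs (fst b - fst a) + Rabs (snd b - snd a))).
  intros s t; unfold seg2; simpl.
  pose proof (Rabs_pos (fst b - fst a)); pose proof (Rabs_pos (snd b - snd a)).
  pose proof (Rabs_pos (t - s)).
  split.
  - replace (_ - _) with ((fst b - fst a) * (t - s)) by ring.
    rewrite Rabs_mult; nra.
  - replace (_ - _) with ((snd b - snd a) * (t - s)) by ring.
    rewrite Rabs_mult; nra.
Qed.

(** One coordinate of [bent]: its three weights are 2-Lipschitz because [Rabs (1 - 2 * t)] is. *)
Lemma tent_lipschitz (x y z s t : R) :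
  Rabs (((1 - 2 * t + Rabs (1 - 2 * t)) / 2 * x + (Rabs (1 - 2 * t) - (1 - 2 * t)) / 2 * y
         + (1 - Rabs (1 - 2 * t)) * z) -
        ((1 - 2 * s + Rabs (1 - 2 * s)) / 2 * x + (Rabs (1 - 2 * s) - (1 - 2 * s)) / 2 * y
         + (1 - Rabs (1 - 2 * s)) * z))
  <= 2 * (Rabs x + Rabs y + Rabs z) * Rabs (t - s).
Proof.
  set (d := Rabs (1 - 2 * t) - Rabs (1 - 2 * s)).
  assert (Hd : Rabs d <= 2 * Rabs (t - s)).
  { unfold d; eapply Rle_trans; [apply Rabs_triang_inv2|].
    replace (1 - 2 * t - (1 - 2 * s)) with (- (2 * (t - s))) by ring.
    rewrite Rabs_Ropp, Rabs_mult, (Rabs_right 2) by lra; lra. }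
  replace (_ - _) with ((- (t - s) + d / 2) * x + ((t - s) + d / 2) * y + - d * z)
    by (unfold d; field).
  assert (H1 : Rabs (- (t - s) + d / 2) <= 2 * Rabs (t - s)).
  { eapply Rle_trans; [apply Rabs_triang|]. rewrite Rabs_Ropp.
    unfold Rdiv; rewrite Rabs_mult, (Rabs_right (/ 2)) by lra; lra. }
  assert (H2 : Rabs (t - s + d / 2) <= 2 * Rabs (t - s)).
  { eapply Rle_trans; [apply Rabs_triang|].
    unfold Rdiv; rewrite Rabs_mult, (Rabs_right (/ 2)) by lra; lra. }
  assert (H3 : Rabs (- d) <= 2 * Rabs (t - s)) by (rewrite Rabs_Ropp; exact Hd).
  eapply Rle_trans; [apply Rabs_triang|].
  eapply Rle_trans; [apply Rplus_le_compat_r, Rabs_triang|].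
  rewrite !Rabs_mult.
  pose proof (Rabs_pos x); pose proof (Rabs_pos y); pose proof (Rabs_pos z).
  nra.
Qed.

Lemma bent_cont01 (a z b : pt2) : cont01 (bent a z b).
Proof.
  apply (lipschitz_cont01 _ (2 * (Rabs (fst a) + Rabs (fst b) + Rabs (fst z)) +
                             2 * (Rabs (snd a) + Rabs (snd b) + Rabs (snd z)))).
  intros s t; unfold bent; cbn [fst snd].
  pose proof (tent_lipschitz (fst a) (fst b) (fst z) s t).
  pose proof (tent_lipschitz (snd a) (snd b) (snd z) s t).
  pose proof (Rabs_pos (fst a)); pose proof (Rabs_pos (fst b)); pose proof (Rabs_pos (fst z)).
  pose proof (Rabs_pos (snd a)); pose proof (Rabs_pos (snd b)); pose proof (Rabs_pos (snd z)).
  pose proof (Rabs_pos (t - s)).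
  split; nra.
Qed.

Lemma seg2_inj01 (a b : pt2) : a <> b -> inj01 (seg2 a b).
Proof.
  intros Hab s t _ _ H; unfold seg2 in H; injection H as H1 H2.
  destruct (Req_dec s t) as [|Hst]; [assumption|exfalso].
  apply Hab, pt2_ext; apply (Rmult_eq_reg_l (s - t)); lra.
Qed.

Lemma bent_endpoints (a z b : pt2) : bent a z b 0 = a /\ bent a z b 1 = b.
Proof.
  split.
  - rewrite bent_first_half by lra; apply pt2_ext; simpl; ring.
  - rewrite bent_second_half by lra; apply pt2_ext; simpl; ring.
Qed.

(* The path [a - z - b] leaves a convex set having [a] and [b] on its boundary:
   the witnesses are supporting affine forms at [a] and at [b], both negative at [z]. *)
Definition outer_path (a z b : pt2) (f g : pt2 -> R) : Prop :=
  f a = 0 /\ 0 <= f b /\ f z < 0 /\ g b = 0 /\ 0 <= g a /\ g z < 0.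

Lemma outer_path_sym (a z b : pt2) (f g : pt2 -> R) :
  outer_path a z b f g -> outer_path b z a g f.
Proof. unfold outer_path; tauto. Qed.

(** The first form is strictly monotone along the first half and the second form along the second
    half; only pairs of points from different halves need both. *)
Lemma bent_inj01 (a z b : pt2) (l m k l' m' k' : R) :
  a <> b -> outer_path a z b (aff l m k) (aff l' m' k') -> inj01 (bent a z b).
Proof.
  intros Hab (Fa & Fb & Fz & Gb & Ga & Gz).
  assert (mixed : forall s t, 0 <= s <= 1 / 2 -> 1 / 2 <= t <= 1 ->
                    bent a z b s = bent a z b t -> s = t).
  { intros s t Hs Ht H.
    rewrite bent_first_half, bent_second_half in H by lra.
    pose proof (f_equal (aff l m k) H) as HF.
    pose proof (f_equal (aff l' m' k') H) as HG.
    rewrite !aff_seg2, Fa in HF; rewrite !aff_seg2, Gb in HG.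
    (* The first form yields [2 s <= 2 - 2 t], the second the converse. The terms in [z] then
       cancel, leaving [(2 t - 1) a = (2 t - 1) b]. *)
    assert (Hst : 2 * s = 2 - 2 * t) by nra.
    destruct (Req_dec t (1 / 2)) as [|Hne]; [lra|exfalso].
    apply Hab; unfold seg2 in H; injection H as H1 H2.
    apply pt2_ext; apply (Rmult_eq_reg_l (2 * t - 1)); try lra;
    replace (2 * s) with (2 - 2 * t) in H1, H2; lra. }
  intros s t Hs Ht H.
  destruct (Rle_dec s (1 / 2)), (Rle_dec t (1 / 2)).
  - rewrite !bent_first_half in H by lra.
    pose proof (f_equal (aff l m k) H) as HF; rewrite !aff_seg2, Fa in HF; nra.
  - apply mixed; lra || assumption.
  - symmetry; apply mixed; [lra..|symmetry; assumption].
  - rewrite !bent_second_half in H by lra.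
    pose proof (f_equal (aff l' m' k') H) as HG; rewrite !aff_seg2, Gb in HG; nra.
Qed.

Lemma bent_outside (a z b : pt2) (l m k l' m' k' t : R) :
  outer_path a z b (aff l m k) (aff l' m' k') -> 0 <= t <= 1 ->
  0 <= aff l m k (bent a z b t) -> 0 <= aff l' m' k' (bent a z b t) ->
  bent a z b t = a \/ bent a z b t = b.
Proof.
  intros (Fa & Fb & Fz & Gb & Ga & Gz) Ht HF HG.
  destruct (Rle_dec t (1 / 2)).
  - left; rewrite bent_first_half in * by lra.
    rewrite aff_seg2, Fa in HF.
    assert (t = 0) by nra; subst; apply pt2_ext; simpl; ring.
  - right; rewrite bent_second_half in * by lra.
    rewrite aff_seg2, Gb in HG.
    assert (t = 1) by nra; subst; apply pt2_ext; simpl; ring.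
Qed.

Lemma same_edge_dec (a b c d : nat) : {same_edge a b c d} + {~ same_edge a b c d}.
Proof.
  unfold same_edge.
  destruct (Nat.eq_dec a c), (Nat.eq_dec b d), (Nat.eq_dec a d), (Nat.eq_dec b c);
    (left; tauto) || (right; tauto).
Qed.

Lemma aff_seg2_nonneg (l m k : R) (a b : pt2) (s : R) :
  0 <= s <= 1 -> 0 <= aff l m k a -> 0 <= aff l m k b -> 0 <= aff l m k (seg2 a b s).
Proof. intros; rewrite aff_seg2; nra. Qed.

(* The new edge is drawn as the bent path, outside the convex hull of the drawing. *)
Lemma planar_add_outer_edge (n : nat) (E : nat -> nat -> Prop) (p : nat -> pt2)
    (u v : nat) (z : pt2) (l m k l' m' k' : R) :
  simple_graph n E -> straight_drawing n E p ->
  (u < n)%nat -> (v < n)%nat -> u <> v -> ~ E u v ->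
  outer_path (p u) z (p v) (aff l m k) (aff l' m' k') ->
  (forall w, (w < n)%nat -> 0 <= aff l m k (p w) /\ 0 <= aff l' m' k' (p w)) ->
  planar n (add_edge E u v).
Proof.
  intros (Ebd & Esym & Eirr) (Pinj & Pvert & Pcross) Hu Hv Huv HnE Hout Hpos.
  assert (Puv : p u <> p v) by (intros H; apply Huv, Pinj; assumption).
  assert (Hnew : forall a b, add_edge E u v a b -> same_edge a b u v \/
                   (E a b /\ ~ same_edge a b u v)).
  { intros a b [H | H]; [right; split; [assumption|] | left; exact H].
    intros [[-> ->] | [-> ->]]; auto. }
  set (g := fun a b => if same_edge_dec a b u v then
                         (if Nat.eq_dec a u then bent (p u) z (p v) else bent (p v) z (p u))
                       else seg2 (p a) (p b)).
  assert (gnew : forall a b t, same_edge a b u v -> 0 <= t <= 1 ->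
            0 <= aff l m k (g a b t) -> 0 <= aff l' m' k' (g a b t) ->
            g a b t = p u \/ g a b t = p v).
  { intros a b t Hab Ht HF HG; unfold g in *.
    destruct (same_edge_dec a b u v); [|tauto].
    destruct (Nat.eq_dec a u).
    - eapply bent_outside; eassumption.
    - apply outer_path_sym in Hout.
      destruct (bent_outside _ _ _ _ _ _ _ _ _ _ Hout Ht HG HF); tauto. }
  assert (gold : forall a b, ~ same_edge a b u v -> g a b = seg2 (p a) (p b)).
  { intros a b H; unfold g; destruct (same_edge_dec a b u v); tauto. }
  assert (crossing : forall a b c d s t, same_edge a b u v -> E c d ->
            ~ same_edge c d u v -> 0 <= s <= 1 -> 0 <= t <= 1 -> g a b s = g c d t ->
            exists w, (w = a \/ w = b) /\ (w = c \/ w = d) /\ g a b s = p w).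
  { intros a b c d s t Hab Hcd Hncd Hs Ht H.
    destruct (Ebd _ _ Hcd) as [Hc Hd].
    rewrite (gold c d Hncd) in H.
    (* Old segments stay in both supporting half-planes, where the bent path has only its two
       ends. *)
    assert (HF : 0 <= aff l m k (g a b s))
      by (rewrite H; apply aff_seg2_nonneg; [|apply Hpos..]; assumption).
    assert (HG : 0 <= aff l' m' k' (g a b s))
      by (rewrite H; apply aff_seg2_nonneg; [|apply Hpos..]; assumption).
    destruct (gnew a b s Hab Hs HF HG) as [Hw | Hw].
    - exists u; repeat split; [destruct Hab; intuition congruence| |assumption].
      rewrite Hw in H; apply (Pvert c d u t); auto.
    - exists v; repeat split; [destruct Hab; intuition congruence| |assumption].
      rewrite Hw in H; apply (Pvert c d v t); auto. }
  exists p, g; split; [exact Pinj|]; split; [|split].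
  - intros a b Hab; destruct (Hnew a b Hab) as [H | [H1 H2]].
    + unfold g; destruct (same_edge_dec a b u v); [|tauto].
      destruct H as [[-> ->] | [-> ->]].
      * destruct (Nat.eq_dec u u); [|tauto].
        destruct (bent_endpoints (p u) z (p v)).
        repeat split; auto using bent_cont01.
        eapply bent_inj01; eassumption.
      * destruct (Nat.eq_dec v u); [congruence|].
        destruct (bent_endpoints (p v) z (p u)).
        repeat split; auto using bent_cont01.
        eapply bent_inj01; [auto|]. apply outer_path_sym; eassumption.
    + rewrite gold by assumption; destruct (Ebd _ _ H1).
      repeat split; try (apply pt2_ext; simpl; ring).
      * apply seg2_cont01.
      * apply seg2_inj01; intros He; apply Pinj in He; auto; subst; eapply Eirr; eassumption.
  - intros a b w s Hab Hw Hs H; destruct (Hnew a b Hab) as [H1 | [H1 H2]].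
    + destruct (Hpos w Hw) as [HF HG]; rewrite <- H in HF, HG.
      destruct (gnew a b s H1 Hs HF HG) as [He | He]; rewrite H in He;
        apply Pinj in He; auto; destruct H1; intuition congruence.
    + rewrite gold in H by assumption; eapply Pvert; eassumption.
  - intros a b c d s t Hab Hcd Hne Hs Ht H.
    destruct (Hnew a b Hab) as [H1 | [H1 H1']], (Hnew c d Hcd) as [H2 | [H2 H2']].
    + exfalso; apply Hne; unfold same_edge in *; intuition congruence.
    + eapply crossing; eassumption.
    + symmetry in H; destruct (crossing c d a b t s H2 H1 H1' Ht Hs H) as (w & ? & ? & ?).
      exists w; repeat split; congruence || assumption.
    + rewrite gold in * by assumption; rewrite gold in * by assumption; eapply Pcross; eassumption.
Qed.

(** * Adjacency of vertices on supporting lines *)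

Lemma supporting_forms_adjacent (n : nat) (E : nat -> nat -> Prop) (p : nat -> pt2)
    (u v : nat) (z : pt2) (l m k l' m' k' : R) :
  maximal_planar n E -> straight_drawing n E p ->
  (u < n)%nat -> (v < n)%nat -> u <> v ->
  (forall w, (w < n)%nat -> 0 <= aff l m k (p w) /\ 0 <= aff l' m' k' (p w)) ->
  aff l m k (p u) = 0 -> aff l' m' k' (p v) = 0 ->
  aff l m k z < 0 -> aff l' m' k' z < 0 ->
  E u v.
Proof.
  intros (Hs & _ & Hmax) Hd Hu Hv Huv Hpos H1 H2 H3 H4.
  apply NNPP; intros HnE; apply (Hmax u v Hu Hv Huv HnE).
  apply (planar_add_outer_edge n E p u v z l m k l' m' k'); auto.
  repeat split; auto; apply Hpos; assumption.
Qed.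

Lemma independent_forms_negative (l m k l' m' k' : R) :
  l * m' - m * l' <> 0 -> exists z, aff l m k z < 0 /\ aff l' m' k' z < 0.
Proof.
  intros H; set (D := l * m' - m * l') in *.
  (* Cramer's rule for the point where both forms equal -1. *)
  exists (((-1 - k) * m' - m * (-1 - k')) / D, (l * (-1 - k') - l' * (-1 - k)) / D).
  unfold aff; simpl.
  assert (H1 : l * (((-1 - k) * m' - m * (-1 - k')) / D) +
               m * ((l * (-1 - k') - l' * (-1 - k)) / D) + k = -1)
    by (unfold D; field; exact H).
  assert (H2 : l' * (((-1 - k) * m' - m * (-1 - k')) / D) +
               m' * ((l * (-1 - k') - l' * (-1 - k)) / D) + k' = -1)
    by (unfold D; field; exact H).
  lra.
Qed.

Lemma independent_supports_adjacent (n : nat) (E : nat -> nat -> Prop) (p : nat -> pt2)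
    (u v : nat) (l m k l' m' k' : R) :
  maximal_planar n E -> straight_drawing n E p ->
  (u < n)%nat -> (v < n)%nat -> u <> v ->
  (forall w, (w < n)%nat -> 0 <= aff l m k (p w) /\ 0 <= aff l' m' k' (p w)) ->
  aff l m k (p u) = 0 -> aff l' m' k' (p v) = 0 ->
  l * m' - m * l' <> 0 ->
  E u v.
Proof.
  intros HM HD Hu Hv Huv Hpos H1 H2 H3.
  destruct (independent_forms_negative l m k l' m' k' H3) as (z & Hz & Hz').
  eapply supporting_forms_adjacent; eassumption.
Qed.

Lemma common_support_adjacent (n : nat) (E : nat -> nat -> Prop) (p : nat -> pt2)
    (u v : nat) (l m k : R) :
  maximal_planar n E -> straight_drawing n E p ->
  (u < n)%nat -> (v < n)%nat -> u <> v ->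
  (forall w, (w < n)%nat -> 0 <= aff l m k (p w)) ->
  aff l m k (p u) = 0 -> aff l m k (p v) = 0 ->
  0 < l * l + m * m ->
  E u v.
Proof.
  intros HM HD Hu Hv Huv Hpos H1 H2 H3.
  assert (Hz : aff l m k (fst (p u) - l, snd (p u) - m) < 0)
    by (unfold aff in *; simpl; lra).
  eapply (supporting_forms_adjacent n E p u v _ l m k l m k); eauto.
Qed.

(** Stated for a total preorder rather than a real-valued key: directions around a vertex are
    compared by [orient], and collinear vertices tie. *)
Lemma finite_minimum (n : nat) (Q : nat -> Prop) (le : nat -> nat -> Prop) :
  (exists i, (i < n)%nat /\ Q i) ->
  (forall i j, (i < n)%nat -> (j < n)%nat -> Q i -> Q j -> le i j \/ le j i) ->
  (forall i j h, (i < n)%nat -> (j < n)%nat -> (h < n)%nat -> Q i -> Q j -> Q h ->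
     le i j -> le j h -> le i h) ->
  exists i, (i < n)%nat /\ Q i /\ forall j, (j < n)%nat -> Q j -> le i j.
Proof.
  induction n as [|n IH]; intros (i0 & Hi0 & Qi0) Htot Htrans; [lia|].
  destruct (classic (exists i, (i < n)%nat /\ Q i)) as [Hex | Hnex].
  - destruct IH as (i & Hi & Qi & Hmin); [assumption| | |].
    + intros; apply Htot; auto.
    + intros i j h ? ? ?; apply Htrans; auto.
    + destruct (classic (Q n)) as [Qn | HQn].
      * destruct (Htot i n ltac:(lia) ltac:(lia) Qi Qn) as [H | H].
        -- exists i; repeat split; auto; intros j Hj Qj.
           destruct (Nat.eq_dec j n) as [-> |]; [assumption|apply Hmin; auto; lia].
        -- exists n; repeat split; auto; intros j Hj Qj.
           destruct (Nat.eq_dec j n) as [-> |].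
           ++ destruct (Htot n n ltac:(lia) ltac:(lia) Qn Qn); assumption.
           ++ apply (Htrans n i j); auto; try lia; apply Hmin; auto; lia.
      * exists i; repeat split; auto; intros j Hj Qj.
        destruct (Nat.eq_dec j n) as [-> |]; [tauto|apply Hmin; auto; lia].
  - assert (Hi : forall j, (j < S n)%nat -> Q j -> j = n).
    { intros j Hj Qj; destruct (Nat.eq_dec j n); auto.
      exfalso; apply Hnex; exists j; split; auto; lia. }
    pose proof (Hi _ Hi0 Qi0); subst i0.
    exists n; repeat split; auto; intros j Hj Qj.
    pose proof (Hi _ Hj Qj); subst j.
    destruct (Htot n n ltac:(lia) ltac:(lia) Qi0 Qi0); assumption.
Qed.

Lemma finite_argmin (n : nat) (f : nat -> R) : (0 < n)%nat ->
  exists i, (i < n)%nat /\ forall j, (j < n)%nat -> f i <= f j.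
Proof.
  intros Hn.
  destruct (finite_minimum n (fun _ => True) (fun i j => f i <= f j)) as (i & Hi & _ & H).
  - exists 0%nat; auto.
  - intros; lra.
  - intros; lra.
  - exists i; auto.
Qed.

(** * The outer face *)

Lemma pt2_eq_of_sq_dist (a b : pt2) :
  (fst a - fst b) ^ 2 + (snd a - snd b) ^ 2 <= 0 -> a = b.
Proof.
  intros H.
  pose proof (pow2_ge_0 (fst a - fst b)); pose proof (pow2_ge_0 (snd a - snd b)).
  apply pt2_ext; apply Rminus_diag_uniq, Rsqr_0_uniq; rewrite Rsqr_pow2; lra.
Qed.

Lemma orient_swap (a b c : pt2) : orient a b c = - orient b a c.
Proof. unfold orient; ring. Qed.

Lemma orient_aff (a b c : pt2) :
  orient a b c = aff (- (snd b - snd a)) (fst b - fst a)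
                     ((snd b - snd a) * fst a - (fst b - fst a) * snd a) c.
Proof. unfold orient, aff; ring. Qed.

(** Grassmann-Pluecker relation. When [orient o _ e] is positive on all vertices other than [o], it
    makes the angular order around [o] transitive. *)
Lemma orient_pluecker (o u v w e : pt2) :
  orient o u w * orient o v e = orient o u v * orient o w e + orient o v w * orient o u e.
Proof. unfold orient; ring. Qed.

Section Drawing.

Context {n : nat} {E : nat -> nat -> Prop} {p : nat -> pt2}.
Context (Hmax : maximal_planar n E) (Hdraw : straight_drawing n E p).

Lemma common_line_adjacent (o a u v : nat) :
  (u < n)%nat -> (v < n)%nat -> u <> v -> p o <> p a ->
  (forall w, (w < n)%nat -> 0 <= orient (p o) (p a) (p w)) ->
  orient (p o) (p a) (p u) = 0 -> orient (p o) (p a) (p v) = 0 -> E u v.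
Proof.
  intros Hu Hv Huv Hoa Hpos H1 H2; rewrite orient_aff in H1, H2.
  eapply common_support_adjacent with (p := p); try eassumption.
  - intros w Hw; rewrite <- orient_aff; auto.
  - apply Rnot_le_lt; intros H; apply Hoa; symmetry; apply pt2_eq_of_sq_dist; lra.
Qed.

Lemma crossing_lines_adjacent (o a o' a' u v : nat) :
  (u < n)%nat -> (v < n)%nat -> u <> v ->
  (forall w, (w < n)%nat -> 0 <= orient (p o) (p a) (p w)) ->
  (forall w, (w < n)%nat -> 0 <= orient (p o') (p a') (p w)) ->
  (fst (p a) - fst (p o)) * (snd (p a') - snd (p o')) -
    (snd (p a) - snd (p o)) * (fst (p a') - fst (p o')) <> 0 ->
  orient (p o) (p a) (p u) = 0 -> orient (p o') (p a') (p v) = 0 -> E u v.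
Proof.
  intros Hu Hv Huv Hpos Hpos' Hind H1 H2; rewrite orient_aff in H1, H2.
  eapply independent_supports_adjacent with (p := p); try eassumption.
  - intros w Hw; rewrite <- !orient_aff; auto.
  - intros H; apply Hind; rewrite <- H; ring.
Qed.

(** Vertices on a supporting line are pairwise adjacent, so of two vertices on the same side of [o]
    the nearer would lie on the edge from [o] to the farther. *)
Lemma no_three_collinear_on_common_line (o a v : nat) :
  (o < n)%nat -> (a < n)%nat -> (v < n)%nat -> o <> a -> o <> v -> a <> v ->
  (forall w, (w < n)%nat -> 0 <= orient (p o) (p a) (p w)) ->
  orient (p o) (p a) (p v) = 0 ->
  forall r, 0 < r ->
  fst (p v) - fst (p o) = r * (fst (p a) - fst (p o)) ->
  snd (p v) - snd (p o) = r * (snd (p a) - snd (p o)) -> False.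
Proof.
  intros Ho Ha Hv Hoa Hov Hav Hpos H0 r Hr H1 H2.
  destruct Hdraw as (Pinj & Pvert & _).
  assert (Poa : p o <> p a) by (intros H; apply Hoa, Pinj; assumption).
  assert (Eoa : E o a) by (apply (common_line_adjacent o a); auto; unfold orient; ring).
  assert (Eov : E o v) by (apply (common_line_adjacent o a); auto; unfold orient; ring).
  destruct (Rle_dec r 1).
  - destruct (Pvert o a v r Eoa Hv); [lra| |congruence|congruence].
    apply pt2_ext; simpl; lra.
  - assert (Hr' : 0 < / r < 1) by (split; [apply Rinv_0_lt_compat; lra|
      rewrite <- Rinv_1; apply Rinv_lt_contravar; lra]).
    destruct (Pvert o v a (/ r) Eov Ha); [lra| |congruence|congruence].
    assert (Hi : / r * r = 1) by (apply Rinv_l; lra).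
    apply pt2_ext; simpl.
    + replace (fst (p v)) with (fst (p o) + r * (fst (p a) - fst (p o))) by lra.
      replace (_ + _) with (fst (p o) + (/ r * r) * (fst (p a) - fst (p o))) by ring.
      rewrite Hi; ring.
    + replace (snd (p v)) with (snd (p o) + r * (snd (p a) - snd (p o))) by lra.
      replace (_ + _) with (snd (p o) + (/ r * r) * (snd (p a) - snd (p o))) by ring.
      rewrite Hi; ring.
Qed.

(* A vertex of maximal norm is a strictly extreme point, so the other vertices are
   linearly preordered by angle around it. *)
Lemma extreme_wedge : (2 <= n)%nat ->
  exists o a b : nat, exists e : pt2,
    (o < n)%nat /\ (a < n)%nat /\ (b < n)%nat /\ a <> o /\ b <> o /\
    (forall v, (v < n)%nat -> v <> o -> 0 < orient (p o) (p v) e) /\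
    (forall v, (v < n)%nat -> 0 <= orient (p o) (p a) (p v)) /\
    (forall v, (v < n)%nat -> 0 <= orient (p b) (p o) (p v)).
Proof.
  intros Hn.
  destruct (finite_argmin n (fun v => - (fst (p v) ^ 2 + snd (p v) ^ 2)) ltac:(lia))
    as (o & Ho & Hnorm).
  (* [orient o v e] is the inner product of [v - o] with [- o]. *)
  set (e := (fst (p o) + snd (p o), snd (p o) - fst (p o))).
  assert (He : forall v, (v < n)%nat -> v <> o -> 0 < orient (p o) (p v) e).
  { intros v Hv Hvo; specialize (Hnorm v Hv).
    (* Since the norm of [v] is at most that of [o], the inner product of [v - o] with [- o] is at
       least half the squared length of [v - o]. *)
    assert (Hne : (fst (p v) - fst (p o)) ^ 2 + (snd (p v) - snd (p o)) ^ 2 > 0).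
    { apply Rnot_le_lt; intros H; apply Hvo; apply (proj1 Hdraw); auto; apply pt2_eq_of_sq_dist; lra. }
    unfold orient, e; simpl in *; nra. }
  assert (Hex : exists i, (i < n)%nat /\ i <> o).
  { destruct (Nat.eq_dec o 0); [exists 1%nat | exists 0%nat]; lia. }
  destruct (finite_minimum n (fun v => v <> o)
              (fun u v => 0 <= orient (p o) (p u) (p v))) as (a & Ha & Hao & Hamin).
  - exact Hex.
  - intros i j _ _ _ _.
    assert (orient (p o) (p i) (p j) = - orient (p o) (p j) (p i)) by (unfold orient; ring).
    lra.
  - intros i j h Hi Hj Hh Qi Qj Qh H1 H2.
    pose proof (orient_pluecker (p o) (p i) (p j) (p h) e).
    pose proof (He i Hi Qi); pose proof (He j Hj Qj); pose proof (He h Hh Qh).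
    nra.
  - destruct (finite_minimum n (fun v => v <> o)
                (fun u v => 0 <= orient (p u) (p o) (p v))) as (b & Hb & Hbo & Hbmin).
    + exact Hex.
    + intros i j _ _ _ _.
      assert (orient (p i) (p o) (p j) = - orient (p j) (p o) (p i)) by (unfold orient; ring).
      lra.
    + intros i j h Hi Hj Hh Qi Qj Qh H1 H2.
      rewrite orient_swap in H1, H2 |- *.
      pose proof (orient_pluecker (p o) (p i) (p j) (p h) e).
      pose proof (He i Hi Qi); pose proof (He j Hj Qj); pose proof (He h Hh Qh).
      nra.
    + exists o, a, b, e; repeat split; auto.
      * intros v Hv; destruct (Nat.eq_dec v o) as [-> |]; [unfold orient; lra|auto].
      * intros v Hv; destruct (Nat.eq_dec v o) as [-> |]; [unfold orient; lra|auto].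
Qed.

(** The rays from an extreme vertex [o] through [a] and [b] bound the drawing. A vertex beyond the
    line [ab] would force an edge from [o] across the edge [ab]. If the wedge is flat, all vertices
    are collinear, which three vertices cannot be. *)
Theorem outer_face_triangle : (3 <= n)%nat ->
  exists a b c : nat, (a < n)%nat /\ (b < n)%nat /\ (c < n)%nat /\
    E a b /\ E b c /\ E c a /\ 0 < orient (p a) (p b) (p c) /\
    forall v, (v < n)%nat -> 0 <= orient (p a) (p b) (p v) /\
      0 <= orient (p b) (p c) (p v) /\ 0 <= orient (p c) (p a) (p v).
Proof.
  intros Hn.
  destruct extreme_wedge as (o & a & b & e & Ho & Ha & Hb & Hao & Hbo & He & Hpa & Hpb);
    [lia|].
  destruct (Rle_lt_or_eq_dec _ _ (Hpa b Hb)) as [HD | HD].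
  - assert (Hab : a <> b) by (intros ->; unfold orient in HD; lra).
    assert (Poa : p o <> p a) by (intros H; apply Hao; symmetry; apply (proj1 Hdraw); auto).
    assert (Pbo : p b <> p o) by (intros H; apply Hbo; apply (proj1 Hdraw); auto).
    assert (Eoa : E o a)
      by (apply (common_line_adjacent o a); auto; unfold orient; ring).
    assert (Ebo : E b o)
      by (apply (common_line_adjacent b o); auto; unfold orient; ring).
    assert (Eab : E a b).
    { apply (crossing_lines_adjacent o a b o); auto; unfold orient in *; lra. }
    exists o, a, b; repeat split; auto.
    destruct (finite_argmin n (fun w => orient (p a) (p b) (p w)) ltac:(lia)) as (d & Hd & Hmin).
    apply Rnot_lt_le; intros Hv.
    assert (Hd0 : orient (p a) (p b) (p d) < 0) by (specialize (Hmin v H); lra).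
    assert (Hdo : o <> d).
    { intros <-; unfold orient in *; lra. }
    assert (Eod : E o d).
    { (* [d] is supported by the line through [d] parallel to [ab]. *)
      eapply (independent_supports_adjacent n E p o d
        (- (snd (p a) - snd (p o))) (fst (p a) - fst (p o))
        ((snd (p a) - snd (p o)) * fst (p o) - (fst (p a) - fst (p o)) * snd (p o))
        (- (snd (p b) - snd (p a))) (fst (p b) - fst (p a))
        ((snd (p b) - snd (p a)) * fst (p a) - (fst (p b) - fst (p a)) * snd (p a)
         - orient (p a) (p b) (p d))); auto.
      - intros w Hw; split; [rewrite <- orient_aff; auto|].
        specialize (Hmin w Hw); rewrite (orient_aff _ _ (p w)) in Hmin.
        unfold aff in *; lra.
      - unfold aff; ring.
      - unfold aff, orient; ring.
      - unfold orient in HD; lra. }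
    set (fa := orient (p o) (p a) (p d)).
    set (fb := orient (p b) (p o) (p d)).
    set (D := orient (p o) (p a) (p b)) in *.
    assert (Hfa : 0 <= fa) by (apply Hpa; auto).
    assert (Hfb : 0 <= fb) by (apply Hpb; auto).
    assert (Hsum : fa + fb = D - orient (p a) (p b) (p d))
      by (unfold fa, fb, D, orient; ring).
    assert (Hf : 0 < fa + fb) by lra.
    (* In barycentric coordinates [d] has weight [fb / D] at [a] and [fa / D] at [b]; scaling
       [d - o] by [D / (fa + fb)] makes them sum to one, that is, lands on [ab]. *)
    destruct (proj2 (proj2 Hdraw) o d a b (D / (fa + fb)) (fa / (fa + fb)) Eod Eab)
      as (z & Hz1 & Hz2 & _).
    + unfold same_edge; intuition congruence.
    + split; [apply Rle_mult_inv_pos; lra|].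
      apply (Rmult_le_reg_r (fa + fb)); [lra|]. unfold Rdiv; rewrite Rmult_assoc, Rinv_l; lra.
    + split; [apply Rle_mult_inv_pos; lra|].
      apply (Rmult_le_reg_r (fa + fb)); [lra|]. unfold Rdiv; rewrite Rmult_assoc, Rinv_l; lra.
    + apply pt2_ext; simpl; apply (Rmult_eq_reg_r (fa + fb)); try lra;
        field_simplify; try lra; unfold fa, fb, D, orient; ring.
    + assert (d <> a) by (intros ->; unfold orient in Hd0; lra).
      assert (d <> b) by (intros ->; unfold orient in Hd0; lra).
      intuition congruence.
  - exfalso.
    assert (Hcol : forall v, (v < n)%nat -> v <> o -> orient (p o) (p a) (p v) = 0).
    { intros v Hv Hvo.
      (* As [orient o a b = 0], the relation equates a nonnegative product with a nonpositive
         one. *)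
      pose proof (orient_pluecker (p o) (p a) (p b) (p v) e) as HP.
      pose proof (He a Ha Hao); pose proof (He b Hb Hbo).
      pose proof (Hpa v Hv); pose proof (Hpb v Hv) as Hbv.
      rewrite orient_swap in Hbv; rewrite <- HD in HP; nra. }
    assert (Hv : exists v, (v < n)%nat /\ v <> o /\ v <> a).
    { destruct (Nat.eq_dec o 0), (Nat.eq_dec a 0), (Nat.eq_dec o 1), (Nat.eq_dec a 1);
        (exists 0%nat; lia) || (exists 1%nat; lia) || (exists 2%nat; lia). }
    destruct Hv as (v & Hv & Hvo & Hva).
    pose proof (Hcol v Hv Hvo) as H0.
    pose proof (He a Ha Hao) as H1; pose proof (He v Hv Hvo) as H2.
    (* This ratio is the factor taking [a - o] to [v - o], positive by the choice of [e]. *)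
    assert (Hr : 0 < orient (p o) (p v) e / orient (p o) (p a) e)
      by (apply Rdiv_lt_0_compat; assumption).
    refine (no_three_collinear_on_common_line o a v Ho Ha Hv _ _ _ Hpa H0 _ Hr _ _);
      try congruence;
      apply (Rmult_eq_reg_r (orient (p o) (p a) e)); try lra;
      field_simplify; try lra.
    + transitivity (fst (p v) * orient (p o) (p a) e - fst (p o) * orient (p o) (p a) e
        - orient (p o) (p a) (p v) * (fst e - fst (p o))); [rewrite H0; ring|].
      unfold orient; ring.
    + transitivity (snd (p v) * orient (p o) (p a) e - snd (p o) * orient (p o) (p a) e
        - orient (p o) (p a) (p v) * (snd e - snd (p o))); [rewrite H0; ring|].
      unfold orient; ring.
Qed.

End Drawing.

(** * The hyperboloid and its Klein projection *)

(** The cosh of the hyperbolic distance. It carries all metric arguments; [arcosh] is unfolded only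
    in [hcosh_separation]. *)
Definition hcosh (x y : pt3) : R := - mink x y.

Definition det3 (x y z : pt3) : R :=
  match x, y, z with (x0, x1, x2), (y0, y1, y2), (z0, z1, z2) =>
    x0 * (y1 * z2 - y2 * z1) - x1 * (y0 * z2 - y2 * z0) + x2 * (y0 * z1 - y1 * z0) end.

Definition klein (x : pt3) : pt2 :=
  (snd (fst x) / fst (fst x), snd x / fst (fst x)).

Lemma hcosh_sym (x y : pt3) : hcosh x y = hcosh y x.
Proof. destruct x as [[? ?] ?], y as [[? ?] ?]; unfold hcosh, mink; ring. Qed.

Lemma hcosh_self (x : pt3) : on_H2 x -> hcosh x x = 1.
Proof. intros [H _]; unfold hcosh; lra. Qed.

(* Reversed Cauchy-Schwarz inequality for time-like vectors. *)
Lemma hcosh_ge_1 (x y : pt3) : on_H2 x -> on_H2 y -> 1 <= hcosh x y.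
Proof.
  destruct x as [[x0 x1] x2], y as [[y0 y1] y2]; unfold hcosh, on_H2, mink; simpl.
  intros [Hx Hx0] [Hy Hy0].
  set (s := x1 * y1 + x2 * y2).
  (* By Lagrange's identity the gap is the squared length of [x - y] plus the square of the cross
     product, both in the space coordinates. *)
  assert (Hs : (s + 1) ^ 2 <= (x0 * y0) ^ 2).
  { assert (Hxx : x0 * x0 = 1 + x1 * x1 + x2 * x2) by lra.
    assert (Hyy : y0 * y0 = 1 + y1 * y1 + y2 * y2) by lra.
    replace ((x0 * y0) ^ 2) with ((x0 * x0) * (y0 * y0)) by ring.
    rewrite Hxx, Hyy; unfold s.
    pose proof (pow2_ge_0 (x1 - y1)); pose proof (pow2_ge_0 (x2 - y2)).
    pose proof (pow2_ge_0 (x1 * y2 - x2 * y1)); lra. }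
  assert (0 < x0 * y0) by (apply Rmult_lt_0_compat; assumption).
  assert (s + 1 <= x0 * y0).
  { apply Rnot_lt_le; intros H1; nra. }
  unfold s in *; lra.
Qed.

(* The Gram determinant of the Minkowski form, which has determinant [-1]. *)
Lemma det3_gram (a c x y : pt3) : on_H2 a -> on_H2 c ->
  det3 a c x * det3 a c y =
  hcosh a c * (hcosh c x * hcosh a y + hcosh a x * hcosh c y)
  - hcosh c x * hcosh c y - hcosh a x * hcosh a y - (hcosh a c ^ 2 - 1) * hcosh x y.
Proof.
  intros [Ha _] [Hc _].
  transitivity (- ((mink a a * mink c c - mink a c ^ 2) * mink x y
     + mink a c * (mink c x * mink a y + mink a x * mink c y)
     - mink a a * mink c x * mink c y - mink c c * mink a x * mink a y)).
  - destruct a as [[? ?] ?], c as [[? ?] ?], x as [[? ?] ?], y as [[? ?] ?].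
    unfold det3, mink; ring.
  - rewrite Ha, Hc; unfold hcosh; ring.
Qed.

Lemma det3_cramer (a b c x : pt3) : 0 < det3 a b c ->
  x = add3 (scal3 (det3 b c x / det3 a b c) a)
        (add3 (scal3 (det3 c a x / det3 a b c) b) (scal3 (det3 a b x / det3 a b c) c)).
Proof.
  intros H.
  destruct a as [[a0 a1] a2], b as [[b0 b1] b2], c as [[c0 c1] c2], x as [[x0 x1] x2].
  unfold add3, scal3, det3 in *; repeat f_equal; field; lra.
Qed.

Lemma det3_orient (a b c : pt3) :
  0 < fst (fst a) -> 0 < fst (fst b) -> 0 < fst (fst c) ->
  det3 a b c = fst (fst a) * fst (fst b) * fst (fst c) * orient (klein a) (klein b) (klein c).
Proof.
  destruct a as [[a0 a1] a2], b as [[b0 b1] b2], c as [[c0 c1] c2].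
  unfold det3, orient, klein; simpl; intros; field; lra.
Qed.

Lemma pt3_ext (x y : pt3) : fst (fst x) = fst (fst y) -> snd (fst x) = snd (fst y) ->
  snd x = snd y -> x = y.
Proof. destruct x as [[? ?] ?], y as [[? ?] ?]; simpl; intros; subst; reflexivity. Qed.

(** A ray from the origin meets the sheet at most once: its slopes [p], [q] fix the height by
    [(1 - p^2 - q^2) * x0^2 = 1]. *)
Lemma klein_inj (x y : pt3) : on_H2 x -> on_H2 y -> klein x = klein y -> x = y.
Proof.
  destruct x as [[x0 x1] x2], y as [[y0 y1] y2]; unfold on_H2, mink, klein; simpl.
  intros [Hx Hx0] [Hy Hy0] H; injection H as H1 H2.
  assert (E1 : x1 = x1 / x0 * x0) by (field; lra).
  assert (E2 : x2 = x2 / x0 * x0) by (field; lra).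
  assert (F1 : y1 = x1 / x0 * y0) by (rewrite H1; field; lra).
  assert (F2 : y2 = x2 / x0 * y0) by (rewrite H2; field; lra).
  set (p := x1 / x0) in *; set (q := x2 / x0) in *; clearbody p q; subst x1 x2 y1 y2.
  assert (x0 = y0).
  { assert (Hx' : (1 - p * p - q * q) * (x0 * x0) = 1) by lra.
    assert (Hy' : (1 - p * p - q * q) * (y0 * y0) = 1) by lra.
    assert (0 < 1 - p * p - q * q) by nra.
    assert (x0 * x0 = y0 * y0) by nra.
    nra. }
  subst; reflexivity.
Qed.

Lemma klein_scale (s : R) (x : pt3) : 0 < s -> 0 < fst (fst x) -> klein (scal3 s x) = klein x.
Proof.
  destruct x as [[x0 x1] x2]; unfold klein, scal3; simpl; intros; f_equal; field; lra.
Qed.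

Lemma seg2_klein (a b : pt3) (t : R) :
  0 < fst (fst a) -> 0 < fst (fst b) -> 0 <= t <= 1 ->
  exists w u, 0 <= w /\ 0 <= u /\ 0 < w + u /\
    klein (add3 (scal3 w a) (scal3 u b)) = seg2 (klein a) (klein b) t /\
    fst (fst (add3 (scal3 w a) (scal3 u b))) = 1.
Proof.
  destruct a as [[a0 a1] a2], b as [[b0 b1] b2]; unfold klein, seg2; simpl; intros Ha Hb Ht.
  assert (Ha' : 0 < / a0) by (apply Rinv_0_lt_compat; assumption).
  assert (Hb' : 0 < / b0) by (apply Rinv_0_lt_compat; assumption).
  (* Dividing by the heights puts both points on the plane of height 1, where the Klein projection
     is affine. *)
  exists ((1 - t) * / a0), (t * / b0).
  replace ((1 - t) * / a0 * a0 + t * / b0 * b0) with 1 by (field; lra).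
  repeat split; try nra.
  f_equal; field; lra.
Qed.

Lemma hseg_of_seg2 (a b x : pt3) (t : R) :
  on_H2 a -> on_H2 b -> on_H2 x -> 0 <= t <= 1 ->
  klein x = seg2 (klein a) (klein b) t -> hseg a b x.
Proof.
  intros [Ha Ha0] [Hb Hb0] [Hx Hx0] Ht H; split; [split; assumption|].
  destruct (seg2_klein a b t Ha0 Hb0 Ht) as (w & u & Hw & Hu & Hwu & Hk & H1).
  rewrite <- H in Hk; clear H Ha Hb Hx.
  exists (u / (w + u)), (fst (fst x) * (w + u)).
  split; [|split].
  - split; [apply Rle_mult_inv_pos; assumption|].
    apply (Rmult_le_reg_r (w + u)); [assumption|].
    unfold Rdiv; rewrite Rmult_assoc, Rinv_l; lra.
  - apply Rmult_lt_0_compat; assumption.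
  - destruct a as [[a0 a1] a2], b as [[b0 b1] b2], x as [[x0 x1] x2].
    unfold klein, add3, scal3 in *; simpl in *; rewrite H1 in Hk; injection Hk as E1 E2.
    assert (x1 = x0 * (w * a1 + u * b1))
      by (replace (w * a1 + u * b1) with (x1 / x0) by lra; field; lra).
    assert (x2 = x0 * (w * a2 + u * b2))
      by (replace (w * a2 + u * b2) with (x2 / x0) by lra; field; lra).
    apply pt3_ext; simpl; field_simplify; try lra.
    replace (x0 * w * a0 + x0 * u * b0) with (x0 * (w * a0 + u * b0)) by ring.
    rewrite H1; ring.
Qed.

(** A nonnegative, nonzero combination of two points of the sheet is time-like and can be
    normalised. This turns a crossing of two chords into a point common to two [hseg]. *)
Lemma seg2_klein_lift (a b : pt3) (t : R) :
  on_H2 a -> on_H2 b -> 0 <= t <= 1 ->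
  exists x, on_H2 x /\ klein x = seg2 (klein a) (klein b) t.
Proof.
  intros Ha Hb Ht.
  pose proof (hcosh_ge_1 a b Ha Hb) as Hab.
  destruct Ha as [Ha Ha0], Hb as [Hb Hb0].
  destruct (seg2_klein a b t Ha0 Hb0 Ht) as (w & u & Hw & Hu & Hwu & Hk & H1).
  set (y := add3 (scal3 w a) (scal3 u b)) in *.
  assert (Hy : - mink y y = w ^ 2 + u ^ 2 + 2 * w * u * hcosh a b).
  { transitivity (- (w ^ 2 * mink a a + u ^ 2 * mink b b + 2 * w * u * mink a b)).
    - unfold y; destruct a as [[? ?] ?], b as [[? ?] ?]; unfold add3, scal3, mink; ring.
    - rewrite Ha, Hb; unfold hcosh; ring. }
  assert (Hpos : 0 < - mink y y).
  { rewrite Hy; assert (0 <= w * u) by nra; nra. }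
  pose proof (sqrt_lt_R0 _ Hpos) as Hs.
  exists (scal3 (/ sqrt (- mink y y)) y).
  assert (Hi : 0 < / sqrt (- mink y y)) by (apply Rinv_0_lt_compat; assumption).
  split; [split|].
  - assert (Hsq : sqrt (- mink y y) * sqrt (- mink y y) = - mink y y)
      by (apply sqrt_sqrt; lra).
    set (r := sqrt (- mink y y)) in *.
    assert (Hm : mink (scal3 (/ r) y) (scal3 (/ r) y) = / r * / r * mink y y).
    { generalize (/ r); intros i; destruct y as [[? ?] ?]; unfold scal3, mink; ring. }
    rewrite Hm; replace (mink y y) with (- (r * r)) by lra; field; lra.
  - destruct y as [[y0 y1] y2]; simpl in *; subst; lra.
  - rewrite klein_scale; auto; lra.
Qed.

Lemma klein_drawing (n : nat) (E : nat -> nat -> Prop) (pos : nat -> pt3) :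
  simple_graph n E -> hyp_drawing n E pos ->
  straight_drawing n E (fun v => klein (pos v)).
Proof.
  intros (Ebd & _) (HH & Hinj & Hvert & Hcross); split; [|split].
  - intros u v Hu Hv H; apply Hinj; auto; apply klein_inj; auto.
  - intros a b w s Hab Hw Hs H; destruct (Ebd _ _ Hab).
    apply Hvert; auto; apply (hseg_of_seg2 _ _ _ s); auto.
  - intros a b c d s t Hab Hcd Hne Hs Ht H.
    destruct (Ebd _ _ Hab), (Ebd _ _ Hcd).
    destruct (seg2_klein_lift (pos a) (pos b) s) as (x & Hx & Hxk); auto.
    destruct (Hcross a b c d x) as (z & Hz1 & Hz2 & ->); auto.
    + apply (hseg_of_seg2 _ _ _ s); auto.
    + apply (hseg_of_seg2 _ _ _ t); auto; congruence.
    + exists z; auto.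
Qed.

Lemma hcosh_separation (c : R) : 0 < c ->
  exists k, 1 < k /\ forall x y, on_H2 x -> on_H2 y -> c <= hdist x y -> k <= hcosh x y.
Proof.
  intros Hc; set (e := exp c).
  assert (He : 1 < e) by (unfold e; rewrite <- exp_0; apply exp_increasing; assumption).
  (* This is [cosh c]. *)
  exists ((e + / e) / 2).
  assert (Hi : e * / e = 1) by (apply Rinv_r; lra).
  assert (Hk : 1 < (e + / e) / 2) by nra.
  split; [exact Hk|].
  intros x y Hx Hy Hd; pose proof (hcosh_ge_1 x y Hx Hy) as Hm.
  unfold hdist, arcosh in Hd; fold (hcosh x y) in Hd; set (m := hcosh x y) in *.
  assert (Hle : e <= m + sqrt (m * m - 1)).
  { unfold e; pose proof (sqrt_pos (m * m - 1)).
    rewrite <- (exp_ln (m + sqrt (m * m - 1))) by lra.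
    destruct (Rle_lt_or_eq_dec _ _ Hd) as [Hlt | ->]; [|lra].
    left; apply exp_increasing; assumption. }
  assert (Hs : sqrt (m * m - 1) * sqrt (m * m - 1) = m * m - 1) by (apply sqrt_sqrt; nra).
  pose proof (sqrt_pos (m * m - 1)).
  set (s := sqrt (m * m - 1)) in *; clearbody s.
  destruct (Rle_dec e m).
  - nra.
  - assert (H2 : (e - m) * (e - m) <= m * m - 1) by nra.
    assert (H3 : e * e + 1 <= 2 * m * e) by lra.
    apply (Rmult_le_reg_r (2 * e)); [lra|].
    replace ((e + / e) / 2 * (2 * e)) with (e * e + e * / e) by (field; lra).
    rewrite Hi; lra.
Qed.

(** * Packing points in a thin triangle *)

(* Fermi coordinates along the geodesic through [a] and [c]: [fermi_q] is sinh of the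
   signed distance [t] to the geodesic, and [fermi_u] is [cosh t * exp s], where [s] is
   the abscissa of the foot of the perpendicular. *)
Definition fermi_q (a c x : pt3) : R := det3 a c x / sqrt (hcosh a c ^ 2 - 1).
Definition fermi_u (a c x : pt3) : R :=
  hcosh a x + (hcosh a c * hcosh a x - hcosh c x) / sqrt (hcosh a c ^ 2 - 1).
Definition fermi_v (a c x : pt3) : R :=
  hcosh a x - (hcosh a c * hcosh a x - hcosh c x) / sqrt (hcosh a c ^ 2 - 1).

Lemma fermi_sigma (y : R) : 1 < y ->
  0 < sqrt (y ^ 2 - 1) /\ sqrt (y ^ 2 - 1) * sqrt (y ^ 2 - 1) = y ^ 2 - 1.
Proof.
  intros H; split; [apply sqrt_lt_R0; nra | apply sqrt_sqrt; nra].
Qed.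

(** The Minkowski form in light-cone coordinates, where it is the polarisation of [u v - q^2]; the
    Gram identity supplies the product of the two determinants. *)
Lemma hcosh_fermi (a c x y : pt3) : on_H2 a -> on_H2 c -> 1 < hcosh a c ->
  hcosh x y = (fermi_u a c x * fermi_v a c y + fermi_v a c x * fermi_u a c y) / 2
              - fermi_q a c x * fermi_q a c y.
Proof.
  intros Ha Hc Hac; pose proof (det3_gram a c x y Ha Hc) as HG.
  destruct (fermi_sigma _ Hac) as [Hs Hss].
  unfold fermi_q, fermi_u, fermi_v.
  set (s := sqrt (hcosh a c ^ 2 - 1)) in *; clearbody s.
  set (A := hcosh a c * hcosh a x - hcosh c x).
  set (B := hcosh a c * hcosh a y - hcosh c y).
  apply (Rmult_eq_reg_r (s * s)); [|nra].
  transitivity (hcosh a x * hcosh a y * (s * s) - A * B - det3 a c x * det3 a c y);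
    [|field; lra].
  rewrite HG, Hss; unfold A, B; ring.
Qed.

(** [fermi_v] is [cosh t * exp (- s)], so its product with [fermi_u] is [cosh^2 t] and their sum is
    [2 * cosh t * cosh s]. *)
Lemma fermi_uv (a c x : pt3) : on_H2 a -> on_H2 c -> on_H2 x -> 1 < hcosh a c ->
  fermi_u a c x * fermi_v a c x = 1 + fermi_q a c x ^ 2 /\
  0 < fermi_u a c x /\ 0 < fermi_v a c x /\
  fermi_u a c x + fermi_v a c x = 2 * hcosh a x.
Proof.
  intros Ha Hc Hx Hac.
  pose proof (hcosh_fermi a c x x Ha Hc Hac) as H; rewrite hcosh_self in H by assumption.
  assert (Hsum : fermi_u a c x + fermi_v a c x = 2 * hcosh a x)
    by (unfold fermi_u, fermi_v; ring).
  pose proof (hcosh_ge_1 a x Ha Hx).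
  assert (Huv : fermi_u a c x * fermi_v a c x = 1 + fermi_q a c x ^ 2) by lra.
  pose proof (pow2_ge_0 (fermi_q a c x)).
  repeat split; auto; nra.
Qed.

Lemma ln_le_mono (x y : R) : 0 < x -> x <= y -> ln x <= ln y.
Proof.
  intros Hx [Hlt | ->]; [left; apply ln_increasing; assumption | apply Rle_refl].
Qed.

(** Both [fermi_u] and [fermi_v] are below their sum [2 * hcosh a x], and their product is at least
    1. *)
Lemma fermi_u_bounds (a c x : pt3) (X : R) :
  on_H2 a -> on_H2 c -> on_H2 x -> 1 < hcosh a c -> hcosh a x <= X ->
  - ln (2 * X) <= ln (fermi_u a c x) <= ln (2 * X).
Proof.
  intros Ha Hc Hx Hac HX.
  destruct (fermi_uv a c x Ha Hc Hx Hac) as (Huv & Hu & Hv & Hsum).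
  pose proof (hcosh_ge_1 a x Ha Hx).
  pose proof (pow2_ge_0 (fermi_q a c x)).
  rewrite <- ln_Rinv by lra.
  split; apply ln_le_mono; try lra.
  - apply Rinv_0_lt_compat; lra.
  - apply (Rmult_le_reg_r (2 * X)); [lra|]; rewrite Rinv_l by lra; nra.
Qed.

(** From [u <= (1 + eta) * u'] follows [u v' <= (1 + eta) * (1 + q'^2)], and symmetrically; what
    remains in [hcosh_fermi] is [(q - q')^2 / 2]. *)
Lemma hcosh_same_cell (a c x y : pt3) (eta eps S : R) :
  on_H2 a -> on_H2 c -> on_H2 x -> on_H2 y -> 1 < hcosh a c -> 0 < eta ->
  Rabs (ln (fermi_u a c x) - ln (fermi_u a c y)) <= ln (1 + eta) ->
  Rabs (fermi_q a c x - fermi_q a c y) < eps ->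
  fermi_q a c x ^ 2 <= S -> fermi_q a c y ^ 2 <= S ->
  hcosh x y < 1 + eps ^ 2 / 2 + eta * (1 + S).
Proof.
  intros Ha Hc Hx Hy Hac Heta Hu Hq Sx Sy.
  rewrite (hcosh_fermi a c x y Ha Hc Hac).
  destruct (fermi_uv a c x Ha Hc Hx Hac) as (UVx & Ux & Vx & _).
  destruct (fermi_uv a c y Ha Hc Hy Hac) as (UVy & Uy & Vy & _).
  set (u := fermi_u a c x) in *; set (v := fermi_v a c x) in *; set (q := fermi_q a c x) in *.
  set (u' := fermi_u a c y) in *; set (v' := fermi_v a c y) in *; set (q' := fermi_q a c y) in *.
  clearbody u v q u' v' q'.
  assert (mono : forall r r', 0 < r -> 0 < r' -> ln r - ln r' <= ln (1 + eta) ->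
                   r <= (1 + eta) * r').
  { intros r r' Hr Hr' H; apply Rnot_lt_le; intros Hlt.
    apply ln_increasing in Hlt; [|nra].
    rewrite ln_mult in Hlt by lra; lra. }
  assert (Hr1 : u <= (1 + eta) * u')
    by (apply mono; auto; pose proof (Rle_abs (ln u - ln u')); lra).
  assert (Hr2 : u' <= (1 + eta) * u)
    by (apply mono; auto; pose proof (Rle_abs (- (ln u - ln u'))) as Hab;
        rewrite Rabs_Ropp in Hab; lra).
  assert (Hq2 : (q - q') ^ 2 < eps ^ 2).
  { rewrite <- (pow2_abs (q - q')); pose proof (Rabs_pos (q - q')); nra. }
  assert (u * v' <= (1 + eta) * (1 + q' ^ 2)) by (rewrite <- UVy; nra).
  assert (v * u' <= (1 + eta) * (1 + q ^ 2)) by (rewrite <- UVx; nra).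
  nra.
Qed.

(** * Counting points by cells *)

Definition nfloor (r : R) : nat := Z.to_nat (Int_part r).

Lemma nfloor_spec (r : R) : 0 <= r -> INR (nfloor r) <= r < INR (nfloor r) + 1.
Proof.
  intros Hr; destruct (base_Int_part r) as [H1 H2].
  assert (0 <= Int_part r)%Z.
  { assert (-1 < Int_part r)%Z by (apply lt_IZR; lra); lia. }
  unfold nfloor; rewrite INR_IZR_INZ, Z2Nat.id by assumption; lra.
Qed.

Lemma nfloor_eq_close (r r' d : R) : 0 < d -> 0 <= r -> 0 <= r' ->
  nfloor (r / d) = nfloor (r' / d) -> Rabs (r - r') < d.
Proof.
  intros Hd Hr Hr' H.
  pose proof (nfloor_spec (r / d) (Rle_mult_inv_pos _ _ Hr Hd)) as H1.
  pose proof (nfloor_spec (r' / d) (Rle_mult_inv_pos _ _ Hr' Hd)) as H2.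
  rewrite H in H1.
  assert (E1 : r = r / d * d) by (field; lra).
  assert (E2 : r' = r' / d * d) by (field; lra).
  rewrite E1, E2; apply Rabs_def1; nra.
Qed.

Lemma nfloor_lt (r r' d : R) : 0 < d -> 0 <= r <= r' ->
  (nfloor (r / d) < S (nfloor (r' / d)))%nat.
Proof.
  intros Hd Hr.
  assert (H : r / d <= r' / d)
    by (apply Rmult_le_compat_r; [left; apply Rinv_0_lt_compat|]; lra).
  pose proof (nfloor_spec (r / d) (Rle_mult_inv_pos _ _ (proj1 Hr) Hd)).
  pose proof (nfloor_spec (r' / d) (Rle_mult_inv_pos r' d ltac:(lra) Hd)).
  apply INR_lt; rewrite S_INR; lra.
Qed.

Lemma pigeonhole_list (T : Type) (n : nat) (f : nat -> T) (l : list T) :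
  (forall i, (i < n)%nat -> In (f i) l) ->
  (forall i j, (i < n)%nat -> (j < n)%nat -> f i = f j -> i = j) ->
  (n <= length l)%nat.
Proof.
  intros Hin Hinj.
  rewrite <- (length_seq n 0), <- (length_map f).
  apply NoDup_incl_length.
  - apply NoDup_map_NoDup_ForallPairs; [|apply seq_NoDup].
    intros i j Hi Hj; apply in_seq in Hi, Hj; apply Hinj; lia.
  - intros x Hx; apply in_map_iff in Hx; destruct Hx as (i & <- & Hi).
    apply in_seq in Hi; apply Hin; lia.
Qed.

Section Triangle.

Context (k X : R) (a b c : pt3).
Context (Hk : 1 < k) (Ha : on_H2 a) (Hb : on_H2 b) (Hc : on_H2 c) (Hdet : 0 < det3 a b c).
Context (Hab : k <= hcosh a b <= X) (Hbc : k <= hcosh b c <= X) (Hac : k <= hcosh a c <= X).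

Definition in_triangle (x : pt3) : Prop :=
  on_H2 x /\ 0 <= det3 a b x /\ 0 <= det3 b c x /\ 0 <= det3 c a x.

(** Cramer's rule; the quadratic identity is [hcosh x x = 1] expanded in [x = r a + s b + t c]. *)
Lemma barycentric (x : pt3) : in_triangle x ->
  exists r s t, 0 <= r /\ 0 <= s /\ 0 <= t /\
    r ^ 2 + s ^ 2 + t ^ 2 + 2 * r * s * hcosh a b + 2 * s * t * hcosh b c
      + 2 * r * t * hcosh a c = 1 /\
    det3 b c x = r * det3 a b c /\ det3 a c x = - s * det3 a b c /\
    hcosh a x = r + s * hcosh a b + t * hcosh a c /\
    hcosh b x = r * hcosh a b + s + t * hcosh b c.
Proof.
  intros (Hx & H1 & H2 & H3).
  pose proof (det3_cramer a b c x Hdet) as Hcr.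
  exists (det3 b c x / det3 a b c), (det3 c a x / det3 a b c), (det3 a b x / det3 a b c).
  assert (Hq1 : det3 b c x = det3 b c x / det3 a b c * det3 a b c) by (field; lra).
  assert (Hq2 : det3 a c x = - (det3 c a x / det3 a b c) * det3 a b c).
  { transitivity (- det3 c a x); [|field; lra].
    destruct a as [[? ?] ?], c as [[? ?] ?], x as [[? ?] ?]; unfold det3; ring. }
  assert (Hr : 0 <= det3 b c x / det3 a b c) by (apply Rle_mult_inv_pos; assumption).
  assert (Hs : 0 <= det3 c a x / det3 a b c) by (apply Rle_mult_inv_pos; assumption).
  assert (Ht : 0 <= det3 a b x / det3 a b c) by (apply Rle_mult_inv_pos; assumption).
  set (r := det3 b c x / det3 a b c) in *.
  set (s := det3 c a x / det3 a b c) in *.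
  set (t := det3 a b x / det3 a b c) in *.
  clearbody r s t.
  pose proof (hcosh_self a Ha) as Ea; pose proof (hcosh_self b Hb) as Eb.
  pose proof (hcosh_self c Hc) as Ec; pose proof (hcosh_self x Hx) as Ex.
  assert (lin : forall y, hcosh y x = r * hcosh y a + s * hcosh y b + t * hcosh y c).
  { intros y; rewrite Hcr.
    destruct a as [[? ?] ?], b as [[? ?] ?], c as [[? ?] ?], y as [[? ?] ?].
    unfold hcosh, mink, add3, scal3; ring. }
  repeat split; auto.
  - rewrite (lin x), !(hcosh_sym x), !lin in Ex.
    rewrite Ea, Eb, Ec, (hcosh_sym b a), (hcosh_sym c a), (hcosh_sym c b) in Ex.
    rewrite <- Ex; ring.
  - rewrite lin, Ea; ring.
  - rewrite lin, Eb, (hcosh_sym b a); ring.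
Qed.

(** The three cosh are at least 1, so the normalisation forces [r + s + t <= 1], and both values are
    at most [(r + s + t) * X]. *)
Lemma in_triangle_close (x : pt3) : in_triangle x -> hcosh a x <= X /\ hcosh b x <= X.
Proof.
  intros Hx.
  destruct (barycentric x Hx) as (r & s & t & Hr & Hs & Ht & H1 & _ & _ & -> & ->).
  assert (Hsum : (r + s + t) ^ 2 <= 1).
  { assert (0 <= r * s) by nra; assert (0 <= s * t) by nra; assert (0 <= r * t) by nra.
    nra. }
  assert (r + s + t <= 1) by nra.
  split; nra.
Qed.

(* Thinness of triangles, as a bound on the product of the two distances: writing [x] in
   barycentric coordinates [r, s, t], the normalisation gives [2 r s cosh(ab) <= 1]. *)
Lemma in_triangle_near_side (x : pt3) : in_triangle x ->
  fermi_q a c x ^ 2 <= k ^ 2 / (k ^ 2 - 1) \/ fermi_q b c x ^ 2 <= k ^ 2 / (k ^ 2 - 1).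
Proof.
  intros Hx.
  destruct (barycentric x Hx) as (r & s & t & Hr & Hs & Ht & H1 & Hd1 & Hd2 & _).
  set (K := k ^ 2 / (k ^ 2 - 1)).
  assert (HK : 0 < K) by (apply Rdiv_lt_0_compat; nra).
  destruct (Rle_dec (fermi_q a c x ^ 2) K) as [|Hn1]; [left; assumption|].
  destruct (Rle_dec (fermi_q b c x ^ 2) K) as [|Hn2]; [right; assumption|exfalso].
  pose proof (det3_gram a b c c Ha Hb) as HG; rewrite (hcosh_self c Hc) in HG.
  destruct (fermi_sigma (hcosh a c) ltac:(lra)) as [Hs1 Hss1].
  destruct (fermi_sigma (hcosh b c) ltac:(lra)) as [Hs2 Hss2].
  assert (Q1 : fermi_q a c x ^ 2 * (hcosh a c ^ 2 - 1) = s ^ 2 * det3 a b c ^ 2).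
  { rewrite <- Hss1; unfold fermi_q; rewrite Hd2; field; lra. }
  assert (Q2 : fermi_q b c x ^ 2 * (hcosh b c ^ 2 - 1) = r ^ 2 * det3 a b c ^ 2).
  { rewrite <- Hss2; unfold fermi_q; rewrite Hd1; field; lra. }
  set (z := hcosh a b) in *; set (y := hcosh a c) in *; set (w := hcosh b c) in *.
  set (D := det3 a b c) in *.
  (* Gram determinant: [D^2 = 2 w y z - w^2 - y^2 - z^2 + 1]. *)
  assert (HD : D ^ 2 <= 2 * w * y * z) by nra.
  assert (Hrs : 2 * (r * s) * z <= 1).
  { assert (0 <= s * t) by nra; assert (0 <= r * t) by nra; nra. }
  (* [K] is coth^2 of the distance with cosh [k]; coth decreases, so [K] bounds coth^2 of every
     side. Far from both sides this yields [y < s D] and [w < r D]. *)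
  assert (B : forall e, k <= e -> e ^ 2 <= K * (e ^ 2 - 1)).
  { intros e He; unfold K; apply (Rmult_le_reg_r (k ^ 2 - 1)); [nra|].
    replace (k ^ 2 / (k ^ 2 - 1) * (e ^ 2 - 1) * (k ^ 2 - 1)) with (k ^ 2 * (e ^ 2 - 1))
      by (field; nra).
    nra. }
  assert (Y : y ^ 2 < s ^ 2 * D ^ 2).
  { rewrite <- Q1; pose proof (B y ltac:(lra)); assert (0 < y ^ 2 - 1) by nra; nra. }
  assert (W : w ^ 2 < r ^ 2 * D ^ 2).
  { rewrite <- Q2; pose proof (B w ltac:(lra)); assert (0 < w ^ 2 - 1) by nra; nra. }
  assert (root : forall e f, 0 <= f -> e ^ 2 < f ^ 2 -> e < f).
  { intros e f Hf Hef; apply Rnot_le_lt; intros Hle; nra. }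
  assert (Y' : y < s * D) by (apply root; nra).
  assert (W' : w < r * D) by (apply root; nra).
  (* The contradiction is [w y < r s D^2 <= 2 r s z w y <= w y]. *)
  assert (P : w * y < (r * D) * (s * D)) by (apply Rmult_le_0_lt_compat; lra).
  assert (0 <= r * s) by nra.
  assert (0 < w * y) by nra.
  assert (r * s * D ^ 2 <= r * s * (2 * w * y * z)) by (apply Rmult_le_compat_l; assumption).
  nra.
Qed.

End Triangle.

(** A cell is given by the near side and the integer parts of the rescaled [ln u] and [q] in the
    Fermi coordinates of that side. Only the range of [ln u] grows with the triangle, like [ln X],
    and no cell holds two points. *)
Lemma triangle_packing (k : R) : 1 < k ->
  exists K1 K2, 0 < K2 /\
  forall (n : nat) (pos : nat -> pt3) (a b c : pt3) (X : R),
    on_H2 a -> on_H2 b -> on_H2 c -> 0 < det3 a b c ->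
    k <= hcosh a b <= X -> k <= hcosh b c <= X -> k <= hcosh a c <= X ->
    (forall i, (i < n)%nat -> in_triangle a b c (pos i)) ->
    (forall i j, (i < n)%nat -> (j < n)%nat -> i <> j -> k <= hcosh (pos i) (pos j)) ->
    INR n <= K1 + K2 * ln X.
Proof.
  intros Hk.
  set (K := k ^ 2 / (k ^ 2 - 1)).
  assert (HK : 0 < K) by (apply Rdiv_lt_0_compat; nra).
  (* [eps] and [eta] each spend half of [k - 1]: [eps^2 / 2 <= (k - 1) / 2] and
     [eta * (1 + K) = (k - 1) / 2]. *)
  set (eps := Rmin 1 (k - 1)).
  assert (Heps : 0 < eps <= 1 /\ eps <= k - 1).
  { unfold eps; repeat split; [apply Rmin_glb_lt; lra | apply Rmin_l | apply Rmin_r]. }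
  set (eta := (k - 1) / (2 * (1 + K))).
  assert (Heta : 0 < eta) by (apply Rdiv_lt_0_compat; lra).
  set (del := ln (1 + eta)).
  assert (Hdel : 0 < del) by (unfold del; rewrite <- ln_1; apply ln_increasing; lra).
  set (M := INR (S (nfloor (2 * sqrt K / eps)))).
  assert (HM : 1 <= M) by (unfold M; rewrite S_INR; pose proof (pos_INR (nfloor (2 * sqrt K / eps))); lra).
  (* Two sides, at most [2 * L / del + 1] cells for [ln u] and [M] for [q], where
     [L = ln 2 + ln X]. *)
  exists (2 * M * (2 * ln 2 / del + 1)), (4 * M / del).
  split; [apply Rdiv_lt_0_compat; lra|].
  intros n pos a b c X Ha Hb Hc Hdet Hab Hbc Hac Htri Hsep.
  set (L := ln (2 * X)).
  assert (HL : 0 < L) by (unfold L; rewrite <- ln_1; apply ln_increasing; lra).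
  set (base := fun x => if Rle_dec (fermi_q a c x ^ 2) K then a else b).
  set (side := fun x => if Rle_dec (fermi_q a c x ^ 2) K then true else false).
  set (code := fun i : nat => (side (pos i),
     (nfloor ((ln (fermi_u (base (pos i)) c (pos i)) + L) / del),
      nfloor ((fermi_q (base (pos i)) c (pos i) + sqrt K) / eps)))).
  assert (Hbase : forall i, (i < n)%nat ->
     on_H2 (base (pos i)) /\ 1 < hcosh (base (pos i)) c /\
     - L <= ln (fermi_u (base (pos i)) c (pos i)) <= L /\
     fermi_q (base (pos i)) c (pos i) ^ 2 <= K).
  { intros i Hi; pose proof (Htri i Hi) as Hin.
    destruct (in_triangle_close k X a b c Hk Ha Hb Hc Hdet Hab Hbc Hac _ Hin).
    unfold base; destruct (Rle_dec (fermi_q a c (pos i) ^ 2) K).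
    - repeat split; try apply Ha; try lra; apply fermi_u_bounds; auto; try lra; apply Hin.
    - repeat split; try apply Hb; try lra; try (apply fermi_u_bounds; auto; try lra; apply Hin).
      destruct (in_triangle_near_side k X a b c Hk Ha Hb Hc Hdet Hab Hbc Hac _ Hin);
        [contradiction|assumption]. }
  assert (Hsq : sqrt K * sqrt K = K) by (apply sqrt_sqrt; lra).
  pose proof (sqrt_pos K) as HsK.
  assert (Hq : forall i, (i < n)%nat ->
     - sqrt K <= fermi_q (base (pos i)) c (pos i) <= sqrt K).
  { intros i Hi; destruct (Hbase i Hi) as (_ & _ & _ & H); split; nra. }
  set (l := list_prod (true :: false :: nil)
              (list_prod (seq 0 (S (nfloor (2 * L / del))))
                         (seq 0 (S (nfloor (2 * sqrt K / eps)))))).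
  assert (Hlen : (n <= length l)%nat).
  { apply (pigeonhole_list _ n code l).
    - intros i Hi; destruct (Hbase i Hi) as (_ & _ & Hu & _); pose proof (Hq i Hi).
      unfold code, l; apply in_prod; [destruct (side (pos i)); simpl; auto|].
      apply in_prod; apply in_seq; split; try lia; apply nfloor_lt; lra.
    - intros i j Hi Hj H; unfold code in H; injection H as H1 H2 H3.
      assert (Hbb : base (pos j) = base (pos i)).
      { revert H1; unfold side, base.
        destruct (Rle_dec (fermi_q a c (pos i) ^ 2) K), (Rle_dec (fermi_q a c (pos j) ^ 2) K);
          congruence. }
      destruct (Hbase i Hi) as (B1 & B2 & B3 & B4), (Hbase j Hj) as (_ & _ & C3 & C4).
      pose proof (Hq i Hi); pose proof (Hq j Hj).
      rewrite Hbb in *.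
      apply nfloor_eq_close in H2; try lra.
      apply nfloor_eq_close in H3; try lra.
      destruct (Nat.eq_dec i j) as [|Hij]; [assumption|exfalso].
      specialize (Hsep i j Hi Hj Hij).
      pose proof (hcosh_same_cell (base (pos i)) c (pos i) (pos j) eta eps K) as Hcell.
      assert (Hlt : hcosh (pos i) (pos j) < 1 + eps ^ 2 / 2 + eta * (1 + K)).
      { apply Hcell; auto.
        - apply Htri; assumption.
        - apply Htri; assumption.
        - fold del; left; replace (_ - _) with
            (ln (fermi_u (base (pos i)) c (pos i)) + L - (ln (fermi_u (base (pos i)) c (pos j)) + L))
            by ring; assumption.
        - replace (_ - _) with
            (fermi_q (base (pos i)) c (pos i) + sqrt K - (fermi_q (base (pos i)) c (pos j) + sqrt K))
            by ring; assumption. }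
      assert (eta * (1 + K) = (k - 1) / 2) by (unfold eta; field; lra).
      nra. }
  apply le_INR in Hlen.
  unfold l in Hlen; rewrite !length_prod, !length_seq, !mult_INR in Hlen; fold M in Hlen.
  rewrite S_INR in Hlen; simpl (INR (length _)) in Hlen.
  assert (HLX : L = ln 2 + ln X) by (unfold L; apply ln_mult; lra).
  pose proof (nfloor_spec (2 * L / del) (Rle_mult_inv_pos (2 * L) del ltac:(lra) Hdel)) as [Hf _].
  assert (Hprod : (INR (nfloor (2 * L / del)) + 1) * M <= (2 * L / del + 1) * M)
    by (apply Rmult_le_compat_r; lra).
  replace (2 * M * (2 * ln 2 / del + 1) + 4 * M / del * ln X) with (2 * ((2 * L / del + 1) * M))
    by (rewrite HLX; field; lra).
  lra.
Qed.

(** * Angles *)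

(** Taylor: [sin x >= x - x^3 / 6], and [1 - x^2 / 6 >= 1 / 3] up to 2. *)
Lemma sin_ge_third (x : R) : 0 <= x <= 2 -> x / 3 <= sin x.
Proof.
  intros Hx.
  destruct (pre_sin_bound x 0) as [H _]; [lra..|].
  unfold sin_approx, sin_term in H; simpl in H; nra.
Qed.

(** The 18 comes from [1 - cos t = 2 * sin (t / 2) ^ 2 >= 2 * (t / 6) ^ 2]. *)
Lemma acos_le_sqrt (w eta : R) : 0 <= eta -> 1 - eta <= w -> acos w <= sqrt (18 * eta).
Proof.
  intros Heta Hw.
  destruct (acos_bound w) as [H0 HPI]; pose proof PI_4.
  apply Rsqr_incr_0_var; [|apply sqrt_pos].
  rewrite Rsqr_sqrt, Rsqr_pow2 by lra.
  destruct (Rle_dec 1 w) as [H1 | H1].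
  - assert (acos w = 0) as ->; [|nra].
    unfold acos; destruct (Rle_dec w (-1)); [lra|].
    destruct (Rle_dec 1 w); [reflexivity|contradiction].
  (* For [w <= -1] one has [eta >= 2], and the crude bound [acos w <= PI <= 4] suffices. *)
  - destruct (Rle_dec w (-1)); [nra|].
    pose proof (cos_acos w ltac:(lra)) as Hcos.
    pose proof (sin_ge_third (acos w / 2) ltac:(lra)) as Hsin.
    pose proof (cos_2a_sin (acos w / 2)) as H2.
    replace (2 * (acos w / 2)) with (acos w) in H2 by field.
    nra.
Qed.

(** Hyperbolic law of cosines: [tangent p q] has Minkowski length sinh of the distance. *)
Lemma hangle_hcosh (p q r : pt3) : on_H2 p -> on_H2 q -> on_H2 r ->
  hangle p q r = acos ((hcosh p q * hcosh p r - hcosh q r) /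
                       sqrt ((hcosh p q ^ 2 - 1) * (hcosh p r ^ 2 - 1))).
Proof.
  intros [Hp _] [Hq _] [Hr _].
  assert (T : forall x y, mink (tangent p x) (tangent p y)
     = mink x y + 2 * mink p x * mink p y + mink p x * mink p y * mink p p).
  { intros x y; destruct p as [[? ?] ?], x as [[? ?] ?], y as [[? ?] ?].
    unfold tangent, add3, scal3, mink; ring. }
  unfold hangle; rewrite !T, Hp, Hq, Hr; unfold hcosh.
  f_equal; f_equal; [ring|]; f_equal; f_equal; ring.
Qed.

(* [cosh(pq - pr) >= 1] and [cosh(qr) - sinh(pr) <= cosh(pr) - sinh(pr) <= 1] bound
   [1 - cos] of the angle at [p] by [1 / sinh(pq)]. *)
Lemma hangle_le (k : R) (p q r : pt3) : 1 < k ->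
  on_H2 p -> on_H2 q -> on_H2 r ->
  k <= hcosh p q -> k <= hcosh p r -> hcosh q r <= hcosh p r ->
  hangle p q r <= sqrt (18 * (sqrt (k ^ 2 / (k ^ 2 - 1)) / hcosh p q)).
Proof.
  intros Hk Hp Hq Hr Hx Hz Hyz.
  rewrite hangle_hcosh by assumption.
  pose proof (hcosh_ge_1 q r Hq Hr) as Hy.
  set (x := hcosh p q) in *; set (z := hcosh p r) in *; set (y := hcosh q r) in *.
  clearbody x y z.
  set (K := k ^ 2 / (k ^ 2 - 1)).
  assert (HK : 0 < K) by (apply Rdiv_lt_0_compat; nra).
  apply acos_le_sqrt; [apply Rle_mult_inv_pos; [apply sqrt_pos|lra]|].
  rewrite sqrt_mult by nra.
  destruct (fermi_sigma x ltac:(lra)) as [Hs Hss].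
  destruct (fermi_sigma z ltac:(lra)) as [Ht Htt].
  set (s := sqrt (x ^ 2 - 1)) in *; set (t := sqrt (z ^ 2 - 1)) in *; clearbody s t.
  (* [sqrt K] bounds coth, which trades [1 / sinh] for a constant over cosh. *)
  assert (Hxs : x <= sqrt K * s).
  { apply Rsqr_incr_0_var; [|apply Rmult_le_pos; [apply sqrt_pos|lra]].
    rewrite Rsqr_mult, Rsqr_sqrt by lra.
    replace (Rsqr s) with (x ^ 2 - 1) by (rewrite <- Hss; reflexivity).
    unfold Rsqr, K; apply (Rmult_le_reg_r (k ^ 2 - 1)); [nra|].
    replace (k ^ 2 / (k ^ 2 - 1) * (x ^ 2 - 1) * (k ^ 2 - 1)) with (k ^ 2 * (x ^ 2 - 1))
      by (field; nra).
    nra. }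
  assert (Hinv : 1 / s <= sqrt K / x).
  { apply (Rmult_le_reg_r (s * x)); [nra|].
    replace (1 / s * (s * x)) with x by (field; lra).
    replace (sqrt K / x * (s * x)) with (sqrt K * s) by (field; lra).
    exact Hxs. }
  assert (H1 : 1 <= x * z - s * t).
  { assert ((s * t + 1) ^ 2 <= (x * z) ^ 2).
    { replace ((s * t + 1) ^ 2) with ((s * s) * (t * t) + 2 * (s * t) + 1) by ring.
      pose proof (pow2_ge_0 (s - t)).
      assert (s * t <= (s * s + t * t) / 2) by nra.
      rewrite Hss, Htt in *; nra. }
    assert (s * t + 1 <= x * z); [|lra].
    assert (0 < x * z) by nra; assert (0 < s * t) by nra.
    apply Rnot_lt_le; intros Hlt; nra. }
  assert (H2 : z - t <= 1) by nra.
  (* With denominators cleared: [x z - s t >= 1 >= z - t >= y - t]. *)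
  apply Rle_trans with (1 - 1 / s); [lra|].
  apply (Rmult_le_reg_r (s * t)); [nra|].
  replace ((1 - 1 / s) * (s * t)) with (s * t - t) by (field; lra).
  replace ((x * z - y) / (s * t) * (s * t)) with (x * z - y) by (field; nra).
  lra.
Qed.

(** The end of [pq] farther from [r] works: its opposite side is at most the other adjacent side. *)
Lemma longest_side_small_angle (k : R) (p q r : pt3) : 1 < k ->
  on_H2 p -> on_H2 q -> on_H2 r ->
  k <= hcosh p q -> k <= hcosh p r -> k <= hcosh q r ->
  let B := sqrt (18 * (sqrt (k ^ 2 / (k ^ 2 - 1)) / hcosh p q)) in
  hangle p q r <= B \/ hangle q p r <= B.
Proof.
  intros Hk Hp Hq Hr H1 H2 H3 B.
  destruct (Rle_dec (hcosh q r) (hcosh p r)).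
  - left; apply hangle_le; auto.
  - right; unfold B; rewrite hcosh_sym; apply hangle_le; auto; rewrite ?(hcosh_sym q p); auto; lra.
Qed.

(** The count gives [ln X >= (n - K1) / K2], and [X^(-1/2)] is the exponential of [- ln X / 2]. *)
Lemma sqrt_inv_exp_le (C K1 K2 X : R) (n : nat) :
  0 < C -> 0 < K2 -> 1 <= X -> INR n <= K1 + K2 * ln X ->
  sqrt (C / X) <= sqrt C * exp (K1 / (2 * K2)) * exp (- / (2 * K2)) ^ n.
Proof.
  intros HC HK HX Hn.
  rewrite <- Rpower_pow by apply exp_pos.
  unfold Rpower; rewrite ln_exp.
  rewrite Rmult_assoc, <- exp_plus.
  assert (Hs : sqrt (C / X) = sqrt C * exp (- (ln X / 2))).
  { unfold Rdiv at 1; rewrite sqrt_mult; [|lra|left; apply Rinv_0_lt_compat; lra].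
    f_equal.
    rewrite <- (exp_ln X) at 1 by lra.
    rewrite <- exp_Ropp.
    replace (- ln X) with (- (ln X / 2) + - (ln X / 2)) by field.
    rewrite exp_plus; apply sqrt_square; left; apply exp_pos. }
  rewrite Hs; apply Rmult_le_compat_l; [apply sqrt_pos|].
  assert (Hle : - (ln X / 2) <= K1 / (2 * K2) + INR n * - / (2 * K2)).
  { apply (Rmult_le_reg_r (2 * K2)); [lra|].
    replace ((K1 / (2 * K2) + INR n * - / (2 * K2)) * (2 * K2)) with (K1 - INR n)
      by (field; lra).
    lra. }
  destruct Hle as [Hlt | ->]; [left; apply exp_increasing; assumption | apply Rle_refl].
Qed.

(** Two edges at a vertex need three vertices, so [3 <= n] allows an angle to be exhibited. *)
Theorem theorem3 :
  forall c : R, 0 < c ->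
  exists A beta : R, 0 < A /\ 0 < beta < 1 /\
    forall (n : nat) (E : nat -> nat -> Prop) (pos : nat -> pt3),
      (3 <= n)%nat ->
      maximal_planar n E ->
      hyp_drawing n E pos ->
      vv_resolution_ge n pos c ->
      angular_resolution_le n E pos (A * beta ^ n).
Proof.
  intros c Hc.
  destruct (hcosh_separation c Hc) as (k & Hk & Hsep).
  destruct (triangle_packing k Hk) as (K1 & K2 & HK2 & Hpack).
  set (C := 18 * sqrt (k ^ 2 / (k ^ 2 - 1))).
  assert (HC : 0 < C).
  { apply Rmult_lt_0_compat; [lra|]; apply sqrt_lt_R0, Rdiv_lt_0_compat; nra. }
  exists (sqrt C * exp (K1 / (2 * K2))), (exp (- / (2 * K2))).
  split; [apply Rmult_lt_0_compat; [apply sqrt_lt_R0; assumption|apply exp_pos]|].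
  assert (0 < / (2 * K2)) by (apply Rinv_0_lt_compat; lra).
  split; [split; [apply exp_pos|rewrite <- exp_0; apply exp_increasing; lra]|].
  intros n E pos Hn Hmax Hdraw Hres.
  pose proof Hdraw as (HH & _).
  pose proof Hmax as ((Ebd & Esym & Eirr) & _).
  assert (Hk' : forall u v, (u < n)%nat -> (v < n)%nat -> u <> v ->
                  k <= hcosh (pos u) (pos v)) by (intros; apply Hsep; auto).
  destruct (outer_face_triangle Hmax (klein_drawing n E pos (proj1 Hmax) Hdraw) Hn)
    as (a & b & d & Ha & Hb & Hd & Eab & Ebd' & Eda & Hor & Hin).
  assert (Hne : forall u v, E u v -> u <> v) by (intros u v He ->; eapply Eirr; eassumption).
  assert (Hdet : 0 < det3 (pos a) (pos b) (pos d)).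
  { rewrite det3_orient by (apply HH; assumption).
    repeat apply Rmult_lt_0_compat; try apply HH; assumption. }
  assert (Hdet0 : forall u v w, (u < n)%nat -> (v < n)%nat -> (w < n)%nat ->
     0 <= orient (klein (pos u)) (klein (pos v)) (klein (pos w)) ->
     0 <= det3 (pos u) (pos v) (pos w)).
  { intros u v w Hu Hv Hw H0; rewrite det3_orient by (apply HH; assumption).
    repeat apply Rmult_le_pos; try (left; apply HH); assumption. }
  (* Once a longest side [p q] is chosen, the packing bound makes [cosh(pq)] exponential in [n]. *)
  assert (finish : forall p q r, (p < n)%nat -> (q < n)%nat -> (r < n)%nat ->
     E p q -> E p r -> E q r ->
     hcosh (pos a) (pos b) <= hcosh (pos p) (pos q) ->
     hcosh (pos b) (pos d) <= hcosh (pos p) (pos q) ->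
     hcosh (pos a) (pos d) <= hcosh (pos p) (pos q) ->
     angular_resolution_le n E pos
       (sqrt C * exp (K1 / (2 * K2)) * exp (- / (2 * K2)) ^ n)).
  { intros p q r Hp Hq Hr Epq Epr Eqr M1 M2 M3.
    assert (Hcount : INR n <= K1 + K2 * ln (hcosh (pos p) (pos q))).
    { apply (Hpack n pos (pos a) (pos b) (pos d)); auto.
      intros i Hi; destruct (Hin i Hi) as (I1 & I2 & I3).
      repeat split; try apply HH; auto. }
    assert (Hbound := sqrt_inv_exp_le C K1 K2 _ n HC HK2
      (hcosh_ge_1 _ _ (HH p Hp) (HH q Hq)) Hcount).
    replace (C / hcosh (pos p) (pos q))
      with (18 * (sqrt (k ^ 2 / (k ^ 2 - 1)) / hcosh (pos p) (pos q))) in Hbound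
      by (unfold C; unfold Rdiv; ring).
    destruct (longest_side_small_angle k (pos p) (pos q) (pos r)) as [Hang | Hang]; auto.
    - exists p, q, r; repeat split; auto; lra.
    - exists q, p, r; repeat split; auto; lra. }
  (* The longest of the three sides plays [p q]; its cosh is the [X] of the packing bound. *)
  destruct (Rle_dec (hcosh (pos a) (pos b)) (hcosh (pos b) (pos d))),
           (Rle_dec (hcosh (pos b) (pos d)) (hcosh (pos a) (pos d))),
           (Rle_dec (hcosh (pos a) (pos b)) (hcosh (pos a) (pos d)));
    first [ apply (finish a b d); auto; lra
          | apply (finish b d a); auto; lra
          | apply (finish a d b); auto; lra ].
Qed.
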